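(* Let $\mathbf{P}=\langle P,\le,\cdot,1\rangle$ be a partially ordered monoid and let $\mathbf{L}$ be a join-completion of the partially ordered set $\langle P,\le\rangle$, regarded as a subset of $\mathcal{L}(\mathbf{P})$ containing $P$ (with the order given by inclusion). The following statements are equivalent: (i) $\mathbf{L}$ can be given a structure of a residuated lattice whose multiplication extends the multiplication of $\mathbf{P}$; (ii) for all $a\in P$ and $b\in L$, $a\backslash_{\mathcal{L}(\mathbf{P})} b\in L$ and $b/_{\mathcal{L}(\mathbf{P})} a\in L$; (iii) $L$ is a nucleus-system of $\mathcal{L}(\mathbf{P})$; (iv) the closure operator $\gamma_L$ associated with $L$ is a nucleus on $\mathcal{L}(\mathbf{P})$. Furthermore, whenever these conditions hold, the multiplication on $\mathbf{L}$ is uniquely determined and the inclusion map $\mathbf{P}\hookrightarrow\mathbf{L}$ preserves, in addition to multiplication, all existing residuals and all existing meets.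
   Context: A partially ordered monoid (pomonoid) is a monoid with a partial order such that multiplication is order-preserving in both arguments. A residuated lattice is an algebra $\langle L,\wedge,\vee,\cdot,\backslash,/,1\rangle$ where $\langle L,\wedge,\vee\rangle$ is a lattice, $\langle L,\cdot,1\rangle$ a monoid, and $xy\le z\iff y\le x\backslash z\iff x\le z/y$ for all $x,y,z$. For a poset $\mathbf{P}$, $\mathcal{L}(\mathbf{P})$ is the set of all order-ideals (down-sets) of $\mathbf{P}$; each $p\in P$ is identified with ${\downarrow}p=\{q\mid q\le p\}$. A join-completion of $\langle P,\le\rangle$ is a complete lattice containing $P$, whose order restricts to that of $P$, in which every element is a join of elements of $P$; every join-completion is isomorphic, via $x\mapsto {\downarrow}x\cap P$, to a subset of $\mathcal{L}(\mathbf{P})$ containing $P$. For a pomonoid $\mathbf{P}$, $\mathcal{L}(\mathbf{P})$ is a residuated lattice with meet $\cap$, join $\cup$, product $X\circ Y={\downarrow}\{xy\mid x\in X,y\in Y\}$, residuals $X\backslash Y=\{z\in P\mid xz\in Y\ \forall x\in X\}$, $Y/X=\{z\in P\mid zx\in Y\ \forall x\in X\}$, unit ${\downarrow}1$; note ${\downarrow}x\circ{\downarrow}y={\downarrow}(xy)$. A closure system of a poset $\mathbf{K}$ is a subset $C$ such that $\gamma_C(x)=\min\{c\in C\mid x\le c\}$ exists for every $x$; $\gamma_C$ is its closure operator. A nucleus on a pomonoid is a closure operator $\gamma$ (order-preserving, $x\le\gamma(x)$, $\gamma\gamma=\gamma$) with $\gamma(a)\gamma(b)\le\gamma(ab)$.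 A nucleus-system of a residuated pomonoid (or residuated lattice) $\mathbf{K}$ is a closure system $C$ with $x\backslash a\in C$ and $a/x\in C$ for all $x\in K$, $a\in C$. *)

(* Defs.v *)
From HB Require Import structures.
From mathcomp Require Import all_boot all_order.
From mathcomp Require Import boolp classical_sets.

Set Implicit Arguments.
Unset Strict Implicit.
Unset Printing Implicit Defensive.

Import Order.TTheory.

Local Open Scope classical_set_scope.
Local Open Scope order_scope.
Local Open Scope group_scope.

HB.mixin Record isPOMonoid (d : Order.disp_t) P of Order.POrder d P & Monoid P := {
  le_mulg : forall x y z t : P, x <= y -> z <= t -> x * z <= y * t
}.

#[short(type="poMonoidType")]
HB.structure Definition POMonoid (d : Order.disp_t) :=
  { P of Order.POrder d P & Monoid P & isPOMonoid d P }.

(* A residuated lattice structure whose lattice order is the given order of T: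
   [rl_lres x z] is x \ z and [rl_rres z y] is z / y. *)
Record residuated_lattice (d : Order.disp_t) (T : porderType d) :=
  ResiduatedLattice {
    rl_meet : T -> T -> T;
    rl_join : T -> T -> T;
    rl_mul : T -> T -> T;
    rl_lres : T -> T -> T;
    rl_rres : T -> T -> T;
    rl_one : T;
    rl_meetP : forall x y, infimums [set x; y] (rl_meet x y);
    rl_joinP : forall x y, supremums [set x; y] (rl_join x y);
    rl_mulA : associative rl_mul;
    rl_mul1l : left_id rl_one rl_mul;
    rl_mul1r : right_id rl_one rl_mul;
    rl_lresP : forall x y z, (rl_mul x y <= z) = (y <= rl_lres x z);
    rl_rresP : forall x y z, (rl_mul x y <= z) = (x <= rl_rres z y)
  }.

Definition is_left_residual (d : Order.disp_t) (P : poMonoidType d)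
    (a b r : P) : Prop :=
  forall c : P, (a * c <= b) = (c <= r).

Definition is_right_residual (d : Order.disp_t) (P : poMonoidType d)
    (b a r : P) : Prop :=
  forall c : P, (c * a <= b) = (c <= r).

Section Closure.
Context {d : Order.disp_t} {K : porderType d}.

Definition least (A : set K) : set K := A `&` lbound A.

Definition closure_system (C : set K) : Prop :=
  forall x, least [set c | C c /\ x <= c] !=set0.

(* The default value x is used only if C is not a closure system. *)
Definition closure_op (C : set K) (x : K) : K :=
  xget x (least [set c | C c /\ x <= c]).

Definition nucleus_system (R : residuated_lattice K) (C : set K) : Prop :=
  closure_system C /\
  forall x a, C a -> C (rl_lres R x a) /\ C (rl_rres R a x).

End Closure.

Definition nucleus (d : Order.disp_t) (K : poMonoidType d) (g : K -> K) : Prop :=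
  [/\ forall x y, x <= y -> g x <= g y,
      forall x, x <= g x,
      forall x, g (g x) = g x
    & forall x y, g x * g y <= g (x * y)].

HB.instance Definition _ (d : Order.disp_t) (T : porderType d) (p : pred T) :=
  [SubChoice_isSubPOrder of {x : T | p x} by <: with d].

Definition complete_lattice (d : Order.disp_t) (L : porderType d) : Prop :=
  forall S : set L, supremums S !=set0 /\ infimums S !=set0.

Definition join_completion (d d' : Order.disp_t) (P : porderType d)
    (L : porderType d') (i : P -> L) : Prop :=
  [/\ complete_lattice L,
      forall p q, (i p <= i q) = (p <= q)
    & forall x : L, exists S : set P, supremums (i @` S) x].

Section Downset.
Context {d : Order.disp_t} {P : porderType d}.

Definition down_closed (X : set P) : Prop :=
  forall p q, X q -> p <= q -> X p.

(* The empty set is an order-ideal. *)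
Record downset := Downset {
  dset :> set P;
  dset_closed : `[< down_closed dset >]
}.

HB.instance Definition _ := [isSub for dset].
HB.instance Definition _ := [Choice of downset by <:].
HB.instance Definition _ :=
  [SubChoice_isSubPOrder of downset by <: with set_display].

Lemma le_downsetP (X Y : downset) : reflect (dset X `<=` dset Y) (X <= Y).
Proof. exact: subsetPset. Qed.

Lemma downset_eqP (X Y : downset) : dset X `<=>` dset Y -> X = Y.
Proof. by move=> XY; apply: val_inj; apply/seteqP. Qed.

Lemma downsetP (X : downset) : down_closed X.
Proof. exact/asboolP/dset_closed. Qed.

Definition mk_downset (X : set P) (h : down_closed X) : downset :=
  Downset (asboolT h).

Lemma downclosure_closed (A : set P) :
  down_closed [set q | exists2 p, A p & q <= p].
Proof. by move=> p q [r Ar qr] pq; exists r => //; exact: le_trans qr. Qed.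

Definition downclosure (A : set P) : downset :=
  mk_downset (@downclosure_closed A).

Lemma principal_closed (p : P) : down_closed [set q | q <= p].
Proof. by move=> q r rp qr; exact: le_trans rp. Qed.

Definition principal (p : P) : downset := mk_downset (@principal_closed p).

Lemma downset_meet_closed (X Y : downset) : down_closed (X `&` Y).
Proof. by move=> p q [Xq Yq] pq; split; apply: downsetP pq. Qed.

Definition downset_meet (X Y : downset) : downset :=
  mk_downset (@downset_meet_closed X Y).

Lemma downset_join_closed (X Y : downset) : down_closed (X `|` Y).
Proof. by move=> p q [Xq|Yq] pq; [left|right]; apply: downsetP pq. Qed.

Definition downset_join (X Y : downset) : downset :=
  mk_downset (@downset_join_closed X Y).

Lemma downset_meetP (X Y : downset) :
  infimums [set X; Y] (downset_meet X Y).
Proof.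
split=> [Z [] ->|Z ZXY]; apply/le_downsetP => p; try by case.
have /le_downsetP ZX : Z <= X by apply: ZXY; left.
have /le_downsetP ZY : Z <= Y by apply: ZXY; right.
by move=> Zp; split; [exact: ZX|exact: ZY].
Qed.

Lemma downset_joinP (X Y : downset) :
  supremums [set X; Y] (downset_join X Y).
Proof.
split=> [Z [] ->|Z ZXY]; apply/le_downsetP => p; try by [left|right].
have /le_downsetP ZX : X <= Z by apply: ZXY; left.
have /le_downsetP ZY : Y <= Z by apply: ZXY; right.
by move=> [/ZX|/ZY].
Qed.

End Downset.
Arguments downset {d} P.

Section DownsetMonoid.
Context {d : Order.disp_t} {P : poMonoidType d}.
Implicit Types X Y Z : downset P.

Definition downset_mul X Y : downset P :=
  downclosure [set x * y | x in X & y in Y].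

Lemma downset_lres_closed X Z :
  down_closed [set z | forall x, dset X x -> dset Z (x * z)].
Proof.
by move=> p q /= h pq x Xx; apply: (downsetP (h x Xx)); exact: le_mulg.
Qed.

Definition downset_lres X Z : downset P :=
  mk_downset (@downset_lres_closed X Z).

Lemma downset_rres_closed Z Y :
  down_closed [set z | forall y, dset Y y -> dset Z (z * y)].
Proof.
by move=> p q /= h pq x Xx; apply: (downsetP (h x Xx)); exact: le_mulg.
Qed.

Definition downset_rres Z Y : downset P :=
  mk_downset (@downset_rres_closed Z Y).

Lemma downset_mulA : associative downset_mul.
Proof.
move=> X Y Z; apply: downset_eqP; split=> p [_ [x Xx [y Yy <-]] pxy] /=.
  case: Yy => _ [y' Yy' [z Zz <-]] yyz.
  exists ((x * y') * z).
    by exists (x * y'); [exists (x * y') => //; exists x => //; exists y'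
                        |exists z].
  by apply: le_trans pxy _; rewrite -mulgA; exact: le_mulg.
case: Xx => _ [x' Xx' [z Zz <-]] xxz.
exists (x' * (z * y)).
  by exists x' => //; exists (z * y) => //; exists (z * y) => //;
     exists z => //; exists y.
by apply: le_trans pxy _; rewrite mulgA; exact: le_mulg.
Qed.

Lemma downset_mul1l : left_id (principal (1 : P)) downset_mul.
Proof.
move=> X; apply: downset_eqP; split=> p.
  case=> _ [x /= x1 [y Xy <-]] pxy; apply: (downsetP Xy).
  by apply: le_trans pxy _; rewrite -[leRHS]mul1g; exact: le_mulg.
by move=> Xp; exists p => //; exists 1 => //=; exists p => //; rewrite mul1g.
Qed.

Lemma downset_mul1r : right_id (principal (1 : P)) downset_mul.
Proof.
move=> X; apply: downset_eqP; split=> p.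
  case=> _ [x Xx [y /= y1 <-]] pxy; apply: (downsetP Xx).
  by apply: le_trans pxy _; rewrite -[leRHS]mulg1; exact: le_mulg.
by move=> Xp; exists p => //; exists p => //=; exists 1 => //=; rewrite mulg1.
Qed.

Lemma downset_lresP X Y Z :
  (downset_mul X Y <= Z) = (Y <= downset_lres X Z).
Proof.
apply/le_downsetP/le_downsetP => h.
  by move=> y Yy x Xx; apply: h; exists (x * y) => //; exists x => //; exists y.
by move=> p [_ [x Xx [y Yy <-]] pxy]; exact: downsetP (h y Yy x Xx) pxy.
Qed.

Lemma downset_rresP X Y Z :
  (downset_mul X Y <= Z) = (X <= downset_rres Z Y).
Proof.
apply/le_downsetP/le_downsetP => h.
  by move=> x Xx y Yy; apply: h; exists (x * y) => //; exists x => //; exists y.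
by move=> p [_ [x Xx [y Yy <-]] pxy]; exact: downsetP (h x Xx y Yy) pxy.
Qed.

Lemma downset_le_mul X Y Z T :
  X <= Y -> Z <= T -> downset_mul X Z <= downset_mul Y T.
Proof.
move=> /le_downsetP XY /le_downsetP ZT; apply/le_downsetP => p.
move=> [_ [x Xx [z Zz <-]] pxz]; exists (x * z) => //.
by exists x; [exact: XY|exists z => //; exact: ZT].
Qed.

HB.instance Definition _ :=
  isMonoid.Build (downset P) downset_mulA downset_mul1l downset_mul1r.
HB.instance Definition _ :=
  isPOMonoid.Build set_display (downset P) downset_le_mul.

Lemma principalM (x y : P) : principal x * principal y = principal (x * y).
Proof.
apply: downset_eqP; split=> p /=.
  by case=> _ [x' /= xx' [y' /= yy' <-]] h; apply: le_trans h _; exact: le_mulg.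
by move=> h; exists (x * y) => //; exists x => //=; exists y => /=.
Qed.

End DownsetMonoid.

Definition downset_rl (d : Order.disp_t) (P : poMonoidType d) :
    residuated_lattice (downset P) :=
  ResiduatedLattice (@downset_meetP d P) (@downset_joinP d P)
    downset_mulA downset_mul1l downset_mul1r downset_lresP downset_rresP.

Lemma downset_rl_mulE (d : Order.disp_t) (P : poMonoidType d)
    (X Y : downset P) : rl_mul (downset_rl P) X Y = X * Y.
Proof. by []. Qed.

Section Completion.
Context {d : Order.disp_t} {P : poMonoidType d} (L : set (downset P)).
Hypothesis PL : forall p : P, principal p \in L.

Definition incl (p : P) : L := exist _ (principal p) (PL p).

Lemma join_completion_closure_system :
  join_completion incl -> closure_system L.
Proof.
move=> [cL _ _] X.
have [_ [M [Mlb Mglb]]] := cL [set Y : L | X <= val Y].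
exists (val M); split=> [|Y [LY XY]].
  split; first exact/set_mem/(valP M).
  apply/le_downsetP => p Xp.
  have : incl p <= M.
    apply: Mglb => Y /= XY; rewrite -Order.le_val /=; apply/le_downsetP => q qp.
    by move/le_downsetP: XY; apply; exact: downsetP Xp qp.
  by rewrite -Order.le_val /= => /le_downsetP; apply => /=.
have := Mlb (exist _ Y (mem_set LY)) XY.
by rewrite -Order.le_val.
Qed.

Definition mul_extends (R : residuated_lattice L) : Prop :=
  forall a b : P, rl_mul R (incl a) (incl b) = incl (a * b).

Definition preserves_residuals (R : residuated_lattice L) : Prop :=
  forall a b r : P,
    (is_left_residual a b r -> rl_lres R (incl a) (incl b) = incl r) /\
    (is_right_residual b a r -> rl_rres R (incl b) (incl a) = incl r).

Definition preserves_meets : Prop :=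
  forall (S : set P) (m : P), infimums S m -> infimums (incl @` S) (incl m).

End Completion.

(* Main.v *)
(* The downsets in L are joins of principal ones, so residuation forces any
   multiplication on L extending that of P to satisfy [x * y <= z] iff
   [x o y <= z], where [o] is the product of downsets.  This determines the
   multiplication, and makes residuals by elements of P computed in L agree with
   those computed in the lattice of all downsets.  Since L is closed under
   intersections and [X \ b] is the intersection of the [a \ b] for [a] in X, L is
   then a nucleus-system.  Conversely, a nucleus g with image L makes L a
   residuated lattice under the multiplication [g (x o y)]. *)

Require Import Defs.
From mathcomp Require Import all_boot all_order.
From mathcomp Require Import boolp classical_sets.

Set Implicit Arguments.
Unset Strict Implicit.
Unset Printing Implicit Defensive.

Import Order.TTheory.

Local Open Scope classical_set_scope.
Local Open Scope order_scope.
Local Open Scope group_scope.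

(** * Closure systems and their closure operators *)

Section ClosureSystem.
Context {d : Order.disp_t} {K : porderType d} {C : set K}.
Implicit Types x y c : K.

(** The least closed element above [x] exists, so [xget] never returns its default value. *)
Lemma closure_op_least x : closure_system C ->
  least [set c | C c /\ x <= c] (closure_op C x).
Proof. by move=> /(_ x)[c cP]; exact: (xgetI x cP). Qed.

Lemma closure_op_in x : closure_system C -> C (closure_op C x).
Proof. by move=> /(closure_op_least x)[[]]. Qed.

Lemma closure_op_ge x : closure_system C -> x <= closure_op C x.
Proof. by move=> /(closure_op_least x)[[]]. Qed.

Lemma closure_op_le x c : closure_system C -> C c ->
  (closure_op C x <= c) = (x <= c).
Proof.
move=> CC Cc; apply/idP/idP => [|xc]; first exact/le_trans/closure_op_ge.
by have [_] := closure_op_least x CC; apply.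
Qed.

Lemma closure_op_id c : closure_system C -> C c -> closure_op C c = c.
Proof.
by move=> CC Cc; apply/eqP; rewrite eq_le closure_op_le// lexx closure_op_ge.
Qed.

Lemma closure_op_homo x y : closure_system C ->
  x <= y -> closure_op C x <= closure_op C y.
Proof.
move=> CC xy; rewrite closure_op_le//; last exact: closure_op_in.
exact/(le_trans xy)/closure_op_ge.
Qed.

(** Each member of [F] is closed and above [m], hence above the closure of [m]; that closure is thus
    a lower bound of [F], so it equals [m]. *)
Lemma closure_system_inf (F : set K) m : closure_system C ->
  F `<=` C -> infimums F m -> C m.
Proof.
move=> CC FC [mlb mglb]; suff <- : closure_op C m = m by exact: closure_op_in.
apply/eqP; rewrite eq_le closure_op_ge// andbT; apply: mglb => c Fc.
by rewrite closure_op_le//; [exact: mlb|exact: FC].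
Qed.

End ClosureSystem.

(** * Principal downsets as test elements for the order *)

Section PrincipalDownsets.
Context {d : Order.disp_t} {P : porderType d}.
Implicit Types (p q : P) (X Y : downset P).

Lemma le_principalP p X : reflect (dset X p) (principal p <= X).
Proof.
apply: (iffP (le_downsetP _ _)) => [|Xp q qp]; first by apply => /=.
exact: downsetP qp.
Qed.

Lemma le_principal p q : (principal p <= principal q) = (p <= q).
Proof. exact/le_principalP/idP. Qed.

Lemma downset_leP X Y :
  (forall p, principal p <= X -> principal p <= Y) <-> X <= Y.
Proof.
split=> [XY|XY p /le_trans]; last exact.
by apply/le_downsetP => p /le_principalP/XY/le_principalP.
Qed.

Lemma eq_downset X Y :
  (forall p, (principal p <= X) = (principal p <= Y)) -> X = Y.
Proof.
by move=> XY; apply/eqP; rewrite eq_le; apply/andP; split;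
  apply/downset_leP => p; rewrite XY.
Qed.

End PrincipalDownsets.

(** * Residuals of downsets, nucleus-systems and nuclei *)

Section DownsetProducts.
Context {d : Order.disp_t} {P : poMonoidType d}.
Implicit Types (X Y Z : downset P) (L : set (downset P)).

Lemma mul_le_lres X Y Z : (X * Y <= Z) = (Y <= downset_lres X Z).
Proof. exact: downset_lresP. Qed.

Lemma mul_le_rres X Y Z : (X * Y <= Z) = (X <= downset_rres Z Y).
Proof. exact: downset_rresP. Qed.

(** A product of downsets is generated by the products of members of its factors, so bounding it
    only involves the multiplication of [P]. *)
Lemma downset_mul_leP X Y Z :
  (forall p q, principal p <= X -> principal q <= Y ->
     principal (p * q) <= Z) <-> X * Y <= Z.
Proof.
split=> [XYZ|XYZ p q pX qY]; last first.
  by rewrite -principalM; apply: le_trans XYZ; exact: le_mulg.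
apply/le_downsetP => r [_ [p Xp [q Yq <-]] rpq].
apply: downsetP rpq; apply/le_principalP.
by apply: XYZ; exact/le_principalP.
Qed.

Lemma nucleus_system_principal L : closure_system L ->
  (forall (a : P) (b : downset P), L b ->
     L (downset_lres (principal a) b) /\ L (downset_rres b (principal a))) ->
  nucleus_system (downset_rl P) L.
Proof.
move=> CL Lres; split=> // X b Lb; split=> /=.
- pose F := [set downset_lres (principal a) b | a in dset X].
  apply: (@closure_system_inf _ _ _ F) => //.
    by move=> _ [a _ <-]; have [] := Lres a b Lb.
  split=> [_ [a Xa <-]|Y Yglb].
    rewrite -mul_le_lres; apply: le_trans (_ : X * downset_lres X b <= b).
      by apply: le_mulg => //; exact/le_principalP.
    by rewrite mul_le_lres.
  rewrite -mul_le_lres; apply/downset_mul_leP => p q /le_principalP Xp qY.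
  rewrite -principalM mul_le_lres; apply: le_trans qY _.
  by apply: Yglb; exists p.
- pose F := [set downset_rres b (principal a) | a in dset X].
  apply: (@closure_system_inf _ _ _ F) => //.
    by move=> _ [a _ <-]; have [] := Lres a b Lb.
  split=> [_ [a Xa <-]|Y Yglb].
    rewrite -mul_le_rres; apply: le_trans (_ : downset_rres b X * X <= b).
      by apply: le_mulg => //; exact/le_principalP.
    by rewrite mul_le_rres.
  rewrite -mul_le_rres; apply/downset_mul_leP => p q pY /le_principalP Xq.
  rewrite -principalM mul_le_rres; apply: le_trans pY _.
  by apply: Yglb; exists q.
Qed.

Lemma nucleus_system_nucleus L :
  nucleus_system (downset_rl P) L -> nucleus (closure_op L).
Proof.
move=> [CL Lres]; split=> [x y|x|x|x y].
- exact: closure_op_homo.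
- exact: closure_op_ge.
- by rewrite closure_op_id//; exact: closure_op_in.
have Lxy := closure_op_in (x * y) CL.
have Ll z : L (downset_lres z (closure_op L (x * y))) by have [] := Lres z _ Lxy.
have Lr z : L (downset_rres (closure_op L (x * y)) z) by have [] := Lres z _ Lxy.
(* Residuals of a closed element are closed, so residuating around one factor at a time strips the
   closure first from [x], then from [y]. *)
rewrite mul_le_rres closure_op_le// -mul_le_rres.
by rewrite mul_le_lres closure_op_le// -mul_le_lres closure_op_ge.
Qed.

(** With g the closure, x g(x\b) <= g(x) g(x\b) <= g(x (x\b)) <= b, so g(x\b) <= x\b and x\b is
    closed; symmetrically for b/x. *)
Lemma nucleus_nucleus_system L : closure_system L ->
  nucleus (closure_op L) -> nucleus_system (downset_rl P) L.
Proof.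
move=> CL [_ _ _ gM]; split=> // x b Lb; split=> /=.
- suff <- : closure_op L (downset_lres x b) = downset_lres x b.
    exact: closure_op_in.
  apply/eqP; rewrite eq_le closure_op_ge// andbT -mul_le_lres.
  apply: le_trans (le_trans (gM x (downset_lres x b)) _).
    by apply: le_mulg => //; exact: closure_op_ge.
  by rewrite closure_op_le// mul_le_lres.
- suff <- : closure_op L (downset_rres b x) = downset_rres b x.
    exact: closure_op_in.
  apply/eqP; rewrite eq_le closure_op_ge// andbT -mul_le_rres.
  apply: le_trans (le_trans (gM (downset_rres b x) x) _).
    by apply: le_mulg => //; exact: closure_op_ge.
  by rewrite closure_op_le// mul_le_rres.
Qed.

End DownsetProducts.

(** * The residuated lattice of closed elements of a nucleus *)

Section NucleusResiduatedLattice.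
Context {d : Order.disp_t} {P : poMonoidType d} {L : set (downset P)}.
Context (PL : forall p : P, principal p \in L).
Context (CL : closure_system L).
Context (gN : nucleus (closure_op L)).
Implicit Types x y z : L.

Let g := closure_op L.

Let gL (X : downset P) : L := exist _ (g X) (mem_set (closure_op_in X CL)).

Let in_L x : L (val x). Proof. exact: set_mem (valP _). Qed.

Let g_le (X : downset P) x : (gL X <= x) = (X <= val x).
Proof. by rewrite -Order.le_val; exact: closure_op_le CL (in_L x). Qed.

Let g_val x : g (val x) = val x.
Proof. exact: closure_op_id CL (in_L x). Qed.

(** Absorbing inner closures, here and in [gMr], reduces associativity of [mul] to that of the
    product of downsets. *)
Let gMl (X Y : downset P) : g (g X * Y) = g (X * Y).
Proof.
have [_ ge _ gM] := gN; apply/eqP; rewrite eq_le; apply/andP; split.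
  rewrite closure_op_le//; last exact: closure_op_in.
  by apply: le_trans (gM _ _); apply: le_mulg => //; exact: ge.
by apply: closure_op_homo => //; apply: le_mulg => //; exact: ge.
Qed.

Let gMr (X Y : downset P) : g (X * g Y) = g (X * Y).
Proof.
have [_ ge _ gM] := gN; apply/eqP; rewrite eq_le; apply/andP; split.
  rewrite closure_op_le//; last exact: closure_op_in.
  by apply: le_trans (gM _ _); apply: le_mulg => //; exact: ge.
by apply: closure_op_homo => //; apply: le_mulg => //; exact: ge.
Qed.

Let NL := nucleus_nucleus_system CL gN.

Let meet_in x y : L (downset_meet (val x) (val y)).
Proof.
apply: closure_system_inf (downset_meetP _ _) => // _ [] ->; exact: in_L.
Qed.

Let lres_in x z : L (downset_lres (val x) (val z)).
Proof. by have [_ /(_ (val x) (val z) (in_L z))[]] := NL. Qed.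

Let rres_in z y : L (downset_rres (val z) (val y)).
Proof. by have [_ /(_ (val y) (val z) (in_L z))[]] := NL. Qed.

Let meet x y : L := exist _ (downset_meet (val x) (val y)) (mem_set (meet_in x y)).
(** Intersections and residuals of members of [L] stay in [L]; unions and products may leave it,
    hence the closure in [join] and [mul]. *)
Let join x y : L := gL (downset_join (val x) (val y)).
Let mul x y : L := gL (val x * val y).
Let lres x z : L := exist _ (downset_lres (val x) (val z)) (mem_set (lres_in x z)).
Let rres z y : L := exist _ (downset_rres (val z) (val y)) (mem_set (rres_in z y)).

Let meetP x y : infimums [set x; y] (meet x y).
Proof.
have [lb glb] := downset_meetP (val x) (val y).
split=> [z xyz|z zlb]; rewrite -Order.le_val.
  by apply: lb; case: xyz => ->; [left|right].
by apply: glb => _ [] ->; rewrite Order.le_val; apply: zlb; [left|right].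
Qed.

Let joinP x y : supremums [set x; y] (join x y).
Proof.
have [ub lub] := downset_joinP (val x) (val y).
split=> [z xyz|z zub]; last first.
  by rewrite g_le; apply: lub => _ [] ->; rewrite Order.le_val; apply: zub;
    [left|right].
rewrite -Order.le_val; apply: le_trans (closure_op_ge _ CL).
by apply: ub; case: xyz => ->; [left|right].
Qed.

Let mulA : associative mul.
Proof. by move=> x y z; apply: val_inj; rewrite /= gMl gMr mulgA. Qed.

Let mul1l : left_id (incl PL 1) mul.
Proof. by move=> x; apply: val_inj; rewrite /= mul1g g_val. Qed.

Let mul1r : right_id (incl PL 1) mul.
Proof. by move=> x; apply: val_inj; rewrite /= mulg1 g_val. Qed.

Let lresP x y z : (mul x y <= z) = (y <= lres x z).
Proof. by rewrite g_le mul_le_lres. Qed.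

Let rresP x y z : (mul x y <= z) = (x <= rres z y).
Proof. by rewrite g_le mul_le_rres. Qed.

Definition nucleus_rl : residuated_lattice L :=
  ResiduatedLattice meetP joinP mulA mul1l mul1r lresP rresP.

Lemma nucleus_rl_mul_extends : mul_extends PL nucleus_rl.
Proof.
by move=> a b; apply: val_inj; rewrite /= principalM -[RHS](g_val (incl PL _)).
Qed.

End NucleusResiduatedLattice.

(** * Consequences of a residuated structure extending [P] *)

Section ResiduatedCompletion.
Context {d : Order.disp_t} {P : poMonoidType d} {L : set (downset P)}.
Context (PL : forall p : P, principal p \in L).
Implicit Types x y z : L.

Lemma le_incl p x : (incl PL p <= x) = (principal p <= val x).
Proof. by rewrite -Order.le_val. Qed.

Lemma incl_leP x y :
  (forall p, incl PL p <= x -> incl PL p <= y) <-> x <= y.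
Proof.
rewrite -Order.le_val -downset_leP.
by split=> xy p; move: (xy p); rewrite !le_incl.
Qed.

Lemma incl_le p q : (incl PL p <= incl PL q) = (p <= q).
Proof. by rewrite le_incl le_principal. Qed.

(** Any element of [P] below a lower bound [x] of the image of [S] is a lower bound of [S], hence
    below [m]; such elements determine [x]. *)
Lemma preserves_meets_incl : preserves_meets PL.
Proof.
move=> S m [mlb mglb]; split=> [_ [s Ss <-]|x xlb].
  by rewrite incl_le; exact: mlb.
apply/incl_leP => p px; rewrite incl_le; apply: mglb => s Ss.
by rewrite -incl_le; apply: le_trans px _; apply: xlb; exists s.
Qed.

Context (R : residuated_lattice L).
Context (Rext : mul_extends PL R).

Lemma rl_mul_le x y z : (rl_mul R x y <= z) = (val x * val y <= val z).
Proof.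
have mul_incl p q : rl_mul R (incl PL p) (incl PL q) <= z <->
    principal (p * q) <= val z by rewrite Rext le_incl.
rewrite rl_lresP; apply/idP/idP => [xyz|/downset_mul_leP xyz].
  apply/downset_mul_leP => p q; rewrite -!le_incl => px qy.
  rewrite le_incl -mul_incl rl_rresP; apply: le_trans px _.
  by rewrite -rl_rresP rl_lresP; exact: le_trans xyz.
(* Each residuation isolates one factor, which can then be replaced by the principal elements below
   it. *)
apply/incl_leP => q qy; rewrite -rl_lresP rl_rresP; apply/incl_leP => p px.
by rewrite -rl_rresP; apply/mul_incl/xyz; rewrite -le_incl.
Qed.

Lemma rl_lresE x z : val (rl_lres R x z) = downset_lres (val x) (val z).
Proof.
apply: eq_downset => p.
by rewrite -le_incl -rl_lresP rl_mul_le mul_le_lres.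
Qed.

Lemma rl_rresE z y : val (rl_rres R z y) = downset_rres (val z) (val y).
Proof.
apply: eq_downset => p.
by rewrite -le_incl -rl_rresP rl_mul_le mul_le_rres.
Qed.

Lemma rl_preserves_residuals : preserves_residuals PL R.
Proof.
move=> a b r; split=> res; apply/val_inj/eq_downset => p.
  rewrite rl_lresE -mul_le_lres principalM.
  by rewrite !le_principal res.
rewrite rl_rresE -mul_le_rres principalM.
by rewrite !le_principal res.
Qed.

End ResiduatedCompletion.

(** By [rl_mul_le], the upper bounds in [L] of either product are those of the product of downsets,
    so each product bounds the other. *)
Lemma rl_mul_unique (d : Order.disp_t) (P : poMonoidType d)
    (L : set (downset P)) (PL : forall p : P, principal p \in L)
    (R R' : residuated_lattice L) :
  mul_extends PL R -> mul_extends PL R' -> rl_mul R =2 rl_mul R'.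
Proof.
move=> Rext R'ext x y; apply/eqP; rewrite eq_le.
by rewrite (rl_mul_le Rext) -(rl_mul_le R'ext) lexx
  (rl_mul_le R'ext) -(rl_mul_le Rext) lexx.
Qed.

Theorem theorem3p5 (d : Order.disp_t) (P : poMonoidType d)
    (L : set (downset P)) (PL : forall p : P, principal p \in L) :
  join_completion (incl PL) ->
  [<-> (exists R : residuated_lattice L, mul_extends PL R);
       (forall (a : P) (b : downset P), L b ->
          L (rl_lres (downset_rl P) (principal a) b) /\
          L (rl_rres (downset_rl P) b (principal a)));
       nucleus_system (downset_rl P) L;
       nucleus (closure_op L)] /\
  (forall R R' : residuated_lattice L,
     mul_extends PL R -> mul_extends PL R' ->
     forall x y : L, rl_mul R x y = rl_mul R' x y) /\
  (forall R : residuated_lattice L, mul_extends PL R ->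
     preserves_residuals PL R /\ preserves_meets PL).
Proof.
move=> /join_completion_closure_system CL; split; [|split].
- tfae.
  + move=> [R Rext] a b /mem_set Lb /=; pose b' : L := exist _ b Lb.
    (* Seen as values of elements of [L], the arguments make each residual the value of a residual
       of [R], hence a member of [L]. *)
    rewrite -[b]/(val b') -[principal a]/(val (incl PL a)).
    by rewrite -(rl_lresE Rext) -(rl_rresE Rext); split; exact: set_mem (valP _).
  + exact: nucleus_system_principal.
  + exact: nucleus_system_nucleus.
  + move=> gN; exists (nucleus_rl PL CL gN); exact: nucleus_rl_mul_extends.
- exact: rl_mul_unique.
- by move=> R Rext; split; [exact: rl_preserves_residuals
                           |exact: preserves_meets_incl].
Qed.
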